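(* For $k\in\mathbb{C}$ and $c\in[0,1]$ let $F_{\mathrm{odd}}(k,c)=i\cos(kc\pi)-i\cos(k\pi)-2\sin(k\pi)$. (i) For any $c\in[0,1]$, any $n\in\mathbb{Z}$ and any real $y\ge0$ one has $F_{\mathrm{odd}}(n+\tfrac12-iy,c)\neq0$. (ii) For any $c\in[0,1]$ and any $k=x-iy$ with $x,y\in\mathbb{R}$ and $y>|x|/\sqrt{3}$ one has $F_{\mathrm{odd}}(k,c)\neq0$.
   Context: The zeros of $F_{\mathrm{odd}}(\cdot,c)$ are called the odd resonances of the quantum graph $\mathcal{G}(c)$, which for $c<1$ is a circle of length $2\pi$ made of two edges of lengths $(1-c)\pi$ and $(1+c)\pi$ joining two vertices, with one infinite lead attached at each vertex, and for $c=1$ is a circle of length $2\pi$ with two leads attached at the same point. The claim itself concerns only the explicit function $F_{\mathrm{odd}}$. *)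

(* Defs.v *)
From Stdlib Require Import Reals.
From Coquelicot Require Export Coquelicot.

Local Open Scope C_scope.

Definition Cexp (z : C) : C :=
  RtoC (exp (Re z)) * (RtoC (cos (Im z)) + Ci * RtoC (sin (Im z))).

Definition Ccos (z : C) : C := (Cexp (Ci * z) + Cexp (- (Ci * z))) / RtoC 2.

Definition Csin (z : C) : C :=
  (Cexp (Ci * z) - Cexp (- (Ci * z))) / (RtoC 2 * Ci).

Lemma Cexp_plus (z w : C) : Cexp (z + w) = Cexp z * Cexp w.
Proof.
destruct z as [a b], w as [c d]; unfold Cexp, Re, Im; simpl.
rewrite exp_plus, cos_plus, sin_plus.
apply injective_projections; simpl; ring.
Qed.

Lemma Cexp_RtoC (x : R) : Cexp (RtoC x) = RtoC (exp x).
Proof.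
unfold Cexp, Re, Im; simpl; rewrite cos_0, sin_0.
apply injective_projections; simpl; ring.
Qed.

Lemma Ccos_RtoC (x : R) : Ccos (RtoC x) = RtoC (cos x).
Proof.
unfold Ccos, Cexp, Re, Im; simpl.
replace (0 * x - 1 * 0)%R with 0%R by ring.
replace (0 * 0 + 1 * x)%R with x by ring.
rewrite Ropp_0, exp_0, cos_neg, sin_neg.
apply injective_projections; simpl; field.
Qed.

Lemma Csin_RtoC (x : R) : Csin (RtoC x) = RtoC (sin x).
Proof.
unfold Csin, Cexp, Re, Im; simpl.
replace (0 * x - 1 * 0)%R with 0%R by ring.
replace (0 * 0 + 1 * x)%R with x by ring.
rewrite Ropp_0, exp_0, cos_neg, sin_neg.
apply injective_projections; simpl; field.
Qed.

Definition F_odd (k : C) (c : R) : C :=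
  Ci * Ccos (k * RtoC c * RtoC PI) - Ci * Ccos (k * RtoC PI)
  - RtoC 2 * Csin (k * RtoC PI).

(* Main.v *)
Require Import Defs.
From Stdlib Require Import Reals.
From Coquelicot Require Import Coquelicot.
From Stdlib Require Import Lra.

(** Put [X = x PI] and [Y = y PI].  At [k = x - i y] the equation
    [F_odd k c = 0] splits into
    - [sin (c X) sinh (c Y) = - sin X (2 cosh Y - sinh Y)] (real part),
    - [cos (c X) cosh (c Y) = cos X (cosh Y - 2 sinh Y)] (imaginary part),
    as [F_odd_parts] shows.

    On the lines [x = n + 1/2] one has [cos X = 0] and [|sin X| = 1], so the
    real part alone asks for [|sinh (c Y)| >= 2 cosh Y - sinh Y].  This is
    impossible, because [sinh (c Y) <= sinh Y < cosh Y].

    In the sector [|X| < sqrt 3 Y] one may take [X >= 0], as both equations are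
    preserved by [X -> - X].
    - If [X = 0], the imaginary part would make [cosh (c Y) >= 1] equal to
      [cosh Y - 2 sinh Y < 1].
    - If [0 < X < PI], the two sides of the real part have opposite signs.
    - If [X >= PI], then [Y > PI / sqrt 3] is large and [cosh Y - 2 sinh Y < 0].
      For [c > 0] this makes [sin X sin (c X)] and [cos X cos (c X)]
      nonpositive; the subtraction formula gives [cos ((1 - c) X) <= 0], so
      [(1 - c) X >= PI / 2] ([phase_gap]), a bound that [X >= PI] provides
      when [c = 0].  The sector condition turns this phase gap into the gap
      [(1 - c) Y >= PI / (2 sqrt 3)], so that [exp (c Y)] is at most half of
      [exp Y].  But comparing moduli gives [cosh (c Y) >= 2 sinh Y - cosh Y]
      ([modulus_bound]), for which [exp (c Y)] would have to exceed that half. *)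

(** * The real and imaginary parts *)

Lemma F_odd_parts (x y c : R) :
  F_odd (RtoC x - Ci * RtoC y)%C c =
  ((- (sin (c * (x * PI)) * sinh (c * (y * PI)))
    - sin (x * PI) * (2 * cosh (y * PI) - sinh (y * PI)))%R,
   (cos (c * (x * PI)) * cosh (c * (y * PI))
    - cos (x * PI) * (cosh (y * PI) - 2 * sinh (y * PI)))%R).
Proof.
assert (HE : forall a b : R, Cexp (a, b) = ((exp a * cos b)%R, (exp a * sin b)%R)).
{ intros a b; unfold Cexp, Re, Im; simpl.
  apply injective_projections; simpl; ring. }
unfold F_odd.
replace ((RtoC x - Ci * RtoC y) * RtoC c * RtoC PI)%C
  with ((c * (x * PI))%R, (- (c * (y * PI)))%R)
  by (apply injective_projections; simpl; ring).
replace ((RtoC x - Ci * RtoC y) * RtoC PI)%C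
  with ((x * PI)%R, (- (y * PI))%R)
  by (apply injective_projections; simpl; ring).
generalize (x * PI)%R (y * PI)%R (c * (x * PI))%R (c * (y * PI))%R.
intros X Y U V; unfold Ccos, Csin.
replace (Ci * (U, (- V)%R))%C with (V, U)
  by (apply injective_projections; simpl; ring).
replace (Ci * (X, (- Y)%R))%C with (Y, X)
  by (apply injective_projections; simpl; ring).
unfold Copp; simpl fst; simpl snd.
rewrite !HE, !cos_neg, !sin_neg; unfold sinh, cosh.
apply injective_projections; simpl; field.
Qed.

Local Open Scope R_scope.

(** * Exponential estimates *)

(** Hyperbolic inequalities below are polynomial inequalities in
    [exp Y], [exp (c Y)] and their inverses, constrained by these relations. *)
Lemma exp_scaled_bounds (c Y : R) : 0 <= c <= 1 -> 0 <= Y ->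
  1 <= exp (c * Y) <= exp Y /\ 0 < exp (- Y) <= exp (- (c * Y)) /\
  exp (- (c * Y)) <= 1 /\
  exp Y * exp (- Y) = 1 /\ exp (c * Y) * exp (- (c * Y)) = 1.
Proof.
intros Hc HY.
assert (Hle : forall a b, a <= b -> exp a <= exp b).
{ intros a b [H | ->]; [left; now apply exp_increasing | right; reflexivity]. }
assert (0 <= c * Y <= Y) by nra.
repeat split.
- rewrite <- exp_0; apply Hle; lra.
- apply Hle; lra.
- apply exp_pos.
- apply Hle; lra.
- rewrite <- exp_0; apply Hle; lra.
- rewrite <- exp_plus, Rplus_opp_r; apply exp_0.
- rewrite <- exp_plus, Rplus_opp_r; apply exp_0.
Qed.

Lemma exp_ge_2 (d : R) : 5 / 6 <= d -> 2 <= exp d.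
Proof.
intros Hd.
(* Since exp t >= 1 + t only gives 11/6 at t = 5/6, it is used at d / 2. *)
assert (H := exp_ineq1_le (d / 2)).
replace d with (d / 2 + d / 2) by field.
rewrite exp_plus; nra.
Qed.

Lemma sqrt_3_bounds : 0 < sqrt 3 < 9 / 5.
Proof.
split; [apply sqrt_lt_R0; lra |].
assert (H := sqrt_sqrt 3 ltac:(lra)).
assert (0 <= sqrt 3) by apply sqrt_pos.
nra.
Qed.

(** * Vertical half-lines *)

Lemma real_part_neq_0_of_cos_eq_0 (c X Y : R) : 0 <= c <= 1 -> 0 <= Y ->
  cos X = 0 ->
  - (sin (c * X) * sinh (c * Y)) - sin X * (2 * cosh Y - sinh Y) <> 0.
Proof.
intros Hc HY HX Heq.
destruct (exp_scaled_bounds c Y Hc HY) as (HB & Hb & Hb1 & HA1 & HB1).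
assert (HsX : sin X * sin X = 1).
{ assert (H := sin2_cos2 X); unfold Rsqr in H; rewrite HX in H; lra. }
assert (HscX : sin (c * X) * sin (c * X) <= 1).
{ assert (H := sin2_cos2 (c * X)); unfold Rsqr in H; nra. }
assert (Hs0 : 0 <= sinh (c * Y)) by (unfold sinh; lra).
assert (Hs : sinh (c * Y) < 2 * cosh Y - sinh Y) by (unfold sinh, cosh; lra).
revert Heq HsX HscX Hs0 Hs.
generalize (sin (c * X)) (sinh (c * Y)) (sin X) (2 * cosh Y - sinh Y).
intros u s v t Heq Hv Hu Hs0 Hs.
assert (H2 : (u * u) * (s * s) = t * t).
{ replace (t * t) with ((v * t) * (v * t)).
  - replace (v * t) with (- (u * s)) by lra; ring.
  - replace (v * t * (v * t)) with ((v * v) * (t * t)) by ring.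
    rewrite Hv; ring. }
assert ((u * u) * (s * s) <= 1 * (s * s)) by (apply Rmult_le_compat_r; nra).
nra.
Qed.

Lemma cos_half_odd_PI (n : Z) : cos ((IZR n + 1 / 2) * PI) = 0.
Proof.
replace ((IZR n + 1 / 2) * PI) with (IZR n * PI + PI / 2) by field.
rewrite cos_plus, cos_PI2, sin_PI2, (sin_eq_0_1 (IZR n * PI)); [ring |].
now exists n.
Qed.

(** * The sector *)

(** Here the two equations say that the vectors [(cos (c X), sin (c X))] and
    [(cos X, sin X)] become opposite when their coordinates are rescaled by
    suitable positive factors.  So each product of corresponding coordinates
    is nonpositive, and the angle [(1 - c) X] between them cannot be acute.
    At [c = 0] the factor [sinh (c Y)] vanishes and this fails. *)
Lemma phase_gap (c X Y : R) : 0 <= c <= 1 -> 0 <= X -> 0 <= Y -> 2 <= exp Y ->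
  - (sin (c * X) * sinh (c * Y)) - sin X * (2 * cosh Y - sinh Y) = 0 ->
  cos (c * X) * cosh (c * Y) - cos X * (cosh Y - 2 * sinh Y) = 0 ->
  0 < c ->
  PI / 2 <= (1 - c) * X.
Proof.
intros Hc HX HY HA Hre Him Hc0.
destruct (exp_scaled_bounds c Y Hc HY) as (HB & Hb & Hb1 & HA1 & HB1).
assert (HYpos : 0 < Y).
{ destruct HY as [HY | <-]; [exact HY | rewrite exp_0 in HA; lra]. }
assert (Hs : 0 < sinh (c * Y)).
{ rewrite <- sinh_0; apply sinh_lt; now apply Rmult_lt_0_compat. }
assert (Hc' : 0 < cosh (c * Y)) by (unfold cosh; lra).
assert (Hp : 0 < 2 * cosh Y - sinh Y) by (unfold sinh, cosh; lra).
assert (Hq : cosh Y - 2 * sinh Y < 0) by (unfold sinh, cosh; nra).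
assert (Hsin : sin X * sin (c * X) <= 0).
{ apply Rmult_le_reg_r with (1 := Hs); rewrite Rmult_assoc.
  replace (sin (c * X) * sinh (c * Y))
    with (- (sin X * (2 * cosh Y - sinh Y))) by lra.
  assert (0 <= (sin X * sin X) * (2 * cosh Y - sinh Y))
    by (apply Rmult_le_pos; [apply Rle_0_sqr | lra]).
  lra. }
assert (Hcos : cos X * cos (c * X) <= 0).
{ apply Rmult_le_reg_r with (1 := Hc'); rewrite Rmult_assoc.
  replace (cos (c * X) * cosh (c * Y))
    with (cos X * (cosh Y - 2 * sinh Y)) by lra.
  assert (0 <= (cos X * cos X) * (2 * sinh Y - cosh Y))
    by (apply Rmult_le_pos; [apply Rle_0_sqr | lra]).
  lra. }
apply Rnot_lt_le; intros Hlt.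
assert (H : 0 < cos ((1 - c) * X)).
{ apply cos_gt_0; [| exact Hlt]. assert (H := PI_RGT_0); nra. }
replace ((1 - c) * X) with (X - c * X) in H by ring.
rewrite cos_minus in H; lra.
Qed.

(** The equations say that [cos (c K) = cos K - 2 i sin K] at [K = X - i Y].
    The left side of the bound is at most the modulus of
    [cos K - 2 i sin K], the right side at least that of [cos (c K)]. *)
Lemma modulus_bound (c X Y : R) : 0 <= Y ->
  - (sin (c * X) * sinh (c * Y)) - sin X * (2 * cosh Y - sinh Y) = 0 ->
  cos (c * X) * cosh (c * Y) - cos X * (cosh Y - 2 * sinh Y) = 0 ->
  2 * sinh Y - cosh Y <= cosh (c * Y).
Proof.
intros HY Hre Him.
assert (HcV : 0 < cosh (c * Y)).
{ unfold cosh; assert (H1 := exp_pos (c * Y)).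
  assert (H2 := exp_pos (- (c * Y))); lra. }
assert (HVV : cosh (c * Y) * cosh (c * Y) - sinh (c * Y) * sinh (c * Y) = 1).
{ assert (H : exp (c * Y) * exp (- (c * Y)) = 1)
    by (rewrite <- exp_plus, Rplus_opp_r; apply exp_0).
  unfold cosh, sinh; nra. }
assert (HYY : cosh Y * cosh Y - sinh Y * sinh Y = 1).
{ assert (H : exp Y * exp (- Y) = 1)
    by (rewrite <- exp_plus, Rplus_opp_r; apply exp_0).
  unfold cosh, sinh; nra. }
assert (HU := sin2_cos2 (c * X)); assert (HX := sin2_cos2 X).
unfold Rsqr in HU, HX.
revert Hre Him HcV HVV HYY HU HX.
generalize (sin (c * X)) (cos (c * X)) (sin X) (cos X)
  (sinh (c * Y)) (cosh (c * Y)) (sinh Y) (cosh Y).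
intros su cu sx cx sv cv sy cy Hre Him HcV HVV HYY HU HX.
assert (Hsq : (su * sv) * (su * sv) + (cu * cv) * (cu * cv) =
  (sx * sx) * ((2 * cy - sy) * (2 * cy - sy)) +
  (cx * cx) * ((cy - 2 * sy) * (cy - 2 * sy))).
{ replace (su * sv) with (- (sx * (2 * cy - sy))) by lra.
  replace (cu * cv) with (cx * (cy - 2 * sy)) by lra.
  ring. }
assert (H1 : (su * sv) * (su * sv) + (cu * cv) * (cu * cv) <= cv * cv).
{ replace (cv * cv) with ((su * su + cu * cu) * (cv * cv))
    by (rewrite HU; ring).
  assert (0 <= su * su) by nra. nra. }
assert (H2 : (2 * sy - cy) * (2 * sy - cy) <= cv * cv).
{ (* The two coefficients differ by 3 (cosh^2 - sinh^2). *)
  replace ((2 * cy - sy) * (2 * cy - sy))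
    with ((cy - 2 * sy) * (cy - 2 * sy) + 3) in Hsq by nra.
  assert (Hcx : cx * cx = 1 - sx * sx) by lra.
  rewrite Hcx in Hsq; nra. }
apply Rnot_lt_le; intros Hlt; nra.
Qed.

Lemma no_zero_in_half_sector (c X Y : R) :
  0 <= c <= 1 -> 0 <= X -> X < sqrt 3 * Y ->
  - (sin (c * X) * sinh (c * Y)) - sin X * (2 * cosh Y - sinh Y) = 0 ->
  cos (c * X) * cosh (c * Y) - cos X * (cosh Y - 2 * sinh Y) = 0 ->
  False.
Proof.
intros Hc HX HXY Hre Him.
assert (Hq := sqrt_3_bounds).
assert (HY : 0 < Y) by nra.
destruct (exp_scaled_bounds c Y Hc (Rlt_le _ _ HY)) as (HB & Hb & Hb1 & HA1 & HB1).
destruct HX as [HX | <-].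
2: { rewrite Rmult_0_r, cos_0 in Him; unfold cosh, sinh in Him.
     assert (H := exp_ineq1_le Y). nra. }
destruct (Rlt_le_dec X PI) as [HP | HP].
- assert (H1 : 0 < sin X) by now apply sin_gt_0.
  assert (H2 : 0 <= sin (c * X)) by (apply sin_ge_0; nra).
  assert (H3 : 0 <= sinh (c * Y)) by (unfold sinh; lra).
  assert (H4 : 0 < 2 * cosh Y - sinh Y) by (unfold sinh, cosh; lra).
  nra.
- assert (HPI := PI2_3_2).
  assert (HY2 : 5 / 6 <= Y / 2) by nra.
  assert (HA : 4 <= exp Y).
  { replace Y with (Y / 2 + Y / 2) by field.
    assert (H := exp_ge_2 _ HY2); rewrite exp_plus; nra. }
  assert (Hgap : 5 / 6 <= (1 - c) * Y).
  { destruct (Rle_lt_or_eq_dec 0 c (proj1 Hc)) as [Hc0 | <-]; [| lra].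
    assert (Hph := phase_gap c X Y Hc (Rlt_le _ _ HX) (Rlt_le _ _ HY)
                     ltac:(lra) Hre Him Hc0).
    assert (H : (1 - c) * X <= sqrt 3 * ((1 - c) * Y)) by nra.
    nra. }
  assert (HAB : 2 * exp (c * Y) <= exp Y).
  { assert (H := exp_ge_2 _ Hgap).
    replace Y with ((1 - c) * Y + c * Y) at 2 by ring.
    rewrite exp_plus; nra. }
  assert (Hm := modulus_bound c X Y (Rlt_le _ _ HY) Hre Him).
  unfold sinh, cosh in Hm; nra.
Qed.

Lemma no_zero_in_sector (c X Y : R) :
  0 <= c <= 1 -> Rabs X < sqrt 3 * Y ->
  - (sin (c * X) * sinh (c * Y)) - sin X * (2 * cosh Y - sinh Y) = 0 ->
  cos (c * X) * cosh (c * Y) - cos X * (cosh Y - 2 * sinh Y) = 0 ->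
  False.
Proof.
intros Hc HXY Hre Him.
destruct (Rle_lt_dec 0 X) as [HX | HX].
- rewrite Rabs_right in HXY by lra.
  now apply (no_zero_in_half_sector c X Y).
- rewrite Rabs_left in HXY by lra.
  apply (no_zero_in_half_sector c (- X) Y); try lra;
    replace (c * - X) with (- (c * X)) by ring;
    rewrite ?sin_neg, ?cos_neg; lra.
Qed.

Theorem theorem6p2 :
  (forall (c : R) (n : Z) (y : R),
     (0 <= c <= 1)%R -> (0 <= y)%R ->
     F_odd (RtoC (IZR n) + RtoC (1 / 2) - Ci * RtoC y)%C c <> RtoC 0) /\
  (forall (c x y : R),
     (0 <= c <= 1)%R -> (y > Rabs x / sqrt 3)%R ->
     F_odd (RtoC x - Ci * RtoC y)%C c <> RtoC 0).
Proof.
assert (HPI := PI_RGT_0).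
split.
- intros c n y Hc Hy H.
  rewrite <- RtoC_plus, F_odd_parts in H.
  injection H as Hre _.
  revert Hre; apply real_part_neq_0_of_cos_eq_0; [exact Hc | nra |].
  apply cos_half_odd_PI.
- intros c x y Hc Hy H.
  rewrite F_odd_parts in H.
  injection H as Hre Him.
  assert (Hq := sqrt_3_bounds).
  apply (no_zero_in_sector c (x * PI) (y * PI)); [exact Hc | | lra | lra].
  rewrite Rabs_mult, (Rabs_right PI) by lra.
  apply (Rmult_lt_compat_r (sqrt 3)) in Hy; [| lra].
  replace (Rabs x / sqrt 3 * sqrt 3) with (Rabs x) in Hy by (field; lra).
  nra.
Qed.
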